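(* Let $f\colon\mathbb{R}^n\to\mathbb{C}\otimes\mathcal{G}_{2n}$ be integrable. Then for all $y\in\mathbb{R}^n$ $$(\mathcal{F} f)(y)=\sum_{s\in\mathcal{J}}M^s(\mathcal{F}_o f)(R_s(y)),\qquad (\mathcal{F}_o f)(y)=\sum_{s\in\mathcal{J}}M^s(\mathcal{F} f)(R_s(y)),$$ $$(\mathcal{F} f)(y)=\sum_{s\in\mathcal{J}}(f\mathcal{F}_o)(R_s(y))M^s,\qquad (f\mathcal{F}_o)(y)=\sum_{s\in\mathcal{J}}(\mathcal{F} f)(R_s(y))M^s.$$ Moreover, whenever the integrals defining the iterated transforms exist (i.e. the first transforms are again integrable), $\mathcal{F}(\mathcal{F} f)=\mathcal{F}_o(\mathcal{F}_o f)$.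
   Context: $\mathcal{G}_{2n}$ is the real Clifford algebra generated by an orthonormal basis $e_1,\dots,e_n,e'_1,\dots,e'_n$ of $\mathbb{R}^{2n}$, with $v^2=v\cdot v$ for all vectors $v$ (so basis vectors square to $1$ and distinct basis vectors anticommute). $\mathbb{C}\otimes\mathcal{G}_{2n}$ is its complexification (tensor product of real algebras); $i$ denotes the imaginary unit of $\mathbb{C}$, which commutes with $\mathcal{G}_{2n}$. $\mathbb{R}^n$ is identified with the span of $e_1,\dots,e_n$. Put $B_k=e_ke'_k$, $k=1,\dots,n$; then $B_k^2=-1$ and $B_jB_k=B_kB_j$. The measure is $dm(x)=(2\pi)^{-n/2}dx$, with $dx$ Lebesgue measure, and $I(x,y)=\sum_{k=1}^nB_kx_ky_k$ for $x,y\in\mathbb{R}^n$. The transforms are $$(\mathcal{F} f)(y)=\int_{\mathbb{R}^n}e^{-ix\cdot y}f(x)\,dm(x),\quad (\mathcal{F}_o f)(y)=\int_{\mathbb{R}^n}e^{-I(x,y)}f(x)\,dm(x),\quad (f\mathcal{F}_o)(y)=\int_{\mathbb{R}^n}f(x)e^{-I(x,y)}\,dm(x).$$ Let $M_k^{+}=\frac12(1+iB_k)$ and $M_k^{-}=\frac12(1-iB_k)$. Let $\mathcal{J}=\{-1,1\}^n$. For $s=(s_1,\dots,s_n)\in\mathcal{J}$ let $M_k^{s_k}=M_k^{+}$ if $s_k=1$ and $M_k^{-}$ if $s_k=-1$, let $M^s=M_1^{s_1}M_2^{s_2}\cdots M_n^{s_n}$, and let $R_s(y)=-(s_1y_1e_1+\cdots+s_ny_ne_n)$.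 *)

(* Defs.v *)
From HB Require Import structures.
From mathcomp Require Import all_boot all_order all_algebra.
From mathcomp Require Import complex.
From mathcomp Require Import all_classical all_reals all_analysis.

Set Implicit Arguments.
Unset Strict Implicit.
Unset Printing Implicit Defensive.
Import Order.TTheory GRing.Theory Num.Theory.
Import numFieldNormedType.Exports.

Local Open Scope ring_scope.

Definition symdiff (T : finType) (A B : {set T}) : {set T} :=
  [set x | (x \in A) (+) (x \in B)].

Section SymDiff.
Variable T : finType.
Implicit Types A B C : {set T}.

Lemma symdiffA : associative (@symdiff T).
Proof. by move=> A B C; apply/setP=> x; rewrite !inE addbA. Qed.

Lemma symdiffC : commutative (@symdiff T).
Proof. by move=> A B; apply/setP=> x; rewrite !inE addbC. Qed.

Lemma symdiff0 : left_id finset.set0 (@symdiff T).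
Proof. by move=> A; apply/setP=> x; rewrite !inE. Qed.

Lemma symdiffv A : symdiff A A = finset.set0.
Proof. by apply/setP=> x; rewrite !inE addbb. Qed.

Lemma symdiffK A : involutive (symdiff A).
Proof. by move=> B; rewrite symdiffA symdiffv symdiff0. Qed.

Lemma symdiffKr A B : symdiff (symdiff A B) B = A.
Proof. by rewrite symdiffC (symdiffC A) symdiffK. Qed.

End SymDiff.

Section Clifford.
Variables (K : comNzRingType) (m : nat).

(* The Clifford algebra over K of the quadratic form sum_i v_i^2 on K^m, given
   by its basis of blades e_A = e_{a_1} * ... * e_{a_k}, where
   A = {a_1 < ... < a_k} ranges over the subsets of 'I_m. The product is
   e_A e_B = (-1)^#{(a, b) in A x B | b < a} e_(A symdiff B): sorting the
   generators of e_A e_B takes one sign per inversion, and the repeated ones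
   cancel because e_i^2 = 1. See clgen_sqr, clgen_anticomm, clvec_sqr, clbladeE
   and cl_blade_sum below. *)
Definition clifford : Type := {ffun {set 'I_m} -> K}.

HB.instance Definition _ := GRing.Zmodule.on clifford.

Implicit Types x y z : clifford.
Implicit Types A B C : {set 'I_m}.

Definition clcoef x A : K := (x : {ffun {set 'I_m} -> K}) A.

Definition clbuild (f : {set 'I_m} -> K) : clifford := [ffun A => f A].

Lemma clbuildE f A : clcoef (clbuild f) A = f A.
Proof. exact: ffunE. Qed.

Lemma clP x y : clcoef x =1 clcoef y <-> x = y.
Proof. by split=> [xy|->//]; apply/ffunP. Qed.

Lemma clcoefD x y A : clcoef (x + y) A = clcoef x A + clcoef y A.
Proof. exact: ffunE. Qed.

Lemma clcoefN x A : clcoef (- x) A = - clcoef x A.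
Proof. exact: ffunE. Qed.

Lemma clcoef0 A : clcoef 0 A = 0.
Proof. exact: ffunE. Qed.

Lemma clcoef_sum (I : Type) (r : seq I) (P : pred I) (F : I -> clifford) A :
  clcoef (\sum_(i <- r | P i) F i) A = \sum_(i <- r | P i) clcoef (F i) A.
Proof.
by apply: (big_morph (fun x => clcoef x A)) => [x y|]; rewrite ?clcoefD ?clcoef0.
Qed.

Definition clsign A B : K := \prod_(a in A) \prod_(b in B) (-1) ^+ (b < a)%N.

Definition clscale (a : K) x : clifford := clbuild (fun A => a * clcoef x A).

Definition clblade A : clifford := clbuild (fun B => (B == A)%:R).

Definition clmul x y : clifford :=
  clbuild (fun C => \sum_A
    clsign A (symdiff A C) * (clcoef x A * clcoef y (symdiff A C))).

Let prod_symdiff (f : 'I_m -> K) A B : (forall i, f i * f i = 1) ->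
  \prod_(i in symdiff A B) f i = (\prod_(i in A) f i) * \prod_(i in B) f i.
Proof.
move=> f2; rewrite big_mkcond [X in _ = X * _]big_mkcond [X in _ = _ * X]big_mkcond.
rewrite -big_split /=; apply: eq_bigr => i _.
by rewrite inE; case: (i \in A); case: (i \in B); rewrite /= ?mulr1 ?mul1r ?f2.
Qed.

Let signr2 (b : bool) : (-1) ^+ b * (-1) ^+ b = 1 :> K.
Proof. by rewrite -signr_addb addbb. Qed.

Let prodsq (P : pred 'I_m) (f : 'I_m -> K) : (forall i, f i * f i = 1) ->
  (\prod_(i | P i) f i) * (\prod_(i | P i) f i) = 1.
Proof. by move=> f2; rewrite -big_split /= big1. Qed.

Lemma clsignDl A B C : clsign (symdiff A B) C = clsign A C * clsign B C.
Proof. by apply: prod_symdiff => i; apply: prodsq => j; apply: signr2. Qed.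

Lemma clsignDr A B C : clsign A (symdiff B C) = clsign A B * clsign A C.
Proof.
rewrite /clsign -big_split; apply: eq_bigr => a _ /=.
by apply: prod_symdiff => i; apply: signr2.
Qed.

Lemma clsign2 A B : clsign A B * clsign A B = 1.
Proof. by apply: prodsq => i; apply: prodsq => j; apply: signr2. Qed.

Lemma clsign0l A : clsign finset.set0 A = 1.
Proof. by rewrite /clsign big_set0. Qed.

Lemma clsign0r A : clsign A finset.set0 = 1.
Proof. by rewrite /clsign big1 // => a _; rewrite big_set0. Qed.

Lemma clmulE x y C : clcoef (clmul x y) C = \sum_A
  clsign A (symdiff A C) * (clcoef x A * clcoef y (symdiff A C)).
Proof. exact: clbuildE. Qed.

Let clmulA : associative clmul.
Proof.
move=> x y z; apply/clP => D; rewrite !clmulE.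
transitivity (\sum_A \sum_B clsign A (symdiff A D) *
   clsign B (symdiff B (symdiff A D)) *
   (clcoef x A * clcoef y B * clcoef z (symdiff B (symdiff A D)))).
  apply: eq_bigr => A _; rewrite clmulE !mulr_sumr; apply: eq_bigr => B _.
  by rewrite [clcoef x A * (_ * _)]mulrCA !mulrA.
transitivity (\sum_E \sum_A clsign E (symdiff E D) * clsign A (symdiff A E) *
   (clcoef x A * clcoef y (symdiff A E) * clcoef z (symdiff E D))); last first.
  apply: eq_bigr => E _; rewrite clmulE mulr_suml mulr_sumr.
  by apply: eq_bigr => A _; rewrite !mulrA.
rewrite [RHS]exchange_big /=; apply: eq_bigr => A _.
rewrite [RHS](reindex_inj (can_inj (symdiffK A))) /=.
apply: eq_bigr => B _; rewrite symdiffK.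
have -> : symdiff (symdiff A B) D = symdiff B (symdiff A D).
  by rewrite symdiffA (symdiffC B A).
congr (_ * _); set F := symdiff B _.
have -> : symdiff A D = symdiff B F by rewrite /F symdiffK.
by rewrite clsignDl clsignDr -mulrA mulrC.
Qed.

Lemma clblade_mull A x C :
  clcoef (clmul (clblade A) x) C = clsign A (symdiff A C) * clcoef x (symdiff A C).
Proof.
rewrite clmulE (bigD1 A) //= big1 ?addr0 => [|B /negPf BA].
  by rewrite clbuildE eqxx mul1r.
by rewrite clbuildE BA mul0r mulr0.
Qed.

Lemma clblade_mulr A x C :
  clcoef (clmul x (clblade A)) C = clsign (symdiff A C) A * clcoef x (symdiff A C).
Proof.
rewrite clmulE (bigD1 (symdiff A C)) //= big1 ?addr0 => [|B /negPf BA].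
  by rewrite clbuildE symdiffKr eqxx mulr1.
rewrite clbuildE; case: eqP => [E|]; last by rewrite !mulr0.
by move: BA; rewrite -E symdiffKr eqxx.
Qed.

Let clmul1 : left_id (clblade finset.set0) clmul.
Proof.
by move=> x; apply/clP => A; rewrite clblade_mull symdiff0 clsign0l mul1r.
Qed.

Let clmulr1 : right_id (clblade finset.set0) clmul.
Proof.
by move=> x; apply/clP => A; rewrite clblade_mulr symdiff0 clsign0r mul1r.
Qed.

Let clmulDl : left_distributive clmul +%R.
Proof.
move=> x y z; apply/clP => A; rewrite clcoefD !clmulE -big_split /=.
by apply: eq_bigr => B _; rewrite clcoefD mulrDl mulrDr.
Qed.

Let clmulDr : right_distributive clmul +%R.
Proof.
move=> x y z; apply/clP => A; rewrite clcoefD !clmulE -big_split /=.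
by apply: eq_bigr => B _; rewrite clcoefD mulrDr mulrDr.
Qed.

Let clone_neq0 : clblade finset.set0 != 0.
Proof.
apply/eqP => /clP /(_ finset.set0).
by rewrite clbuildE eqxx clcoef0 => /eqP; rewrite oner_eq0.
Qed.

HB.instance Definition _ := GRing.Zmodule_isNzRing.Build clifford
  clmulA clmul1 clmulr1 clmulDl clmulDr clone_neq0.

Lemma clcoefM x y C : clcoef (x * y) C = \sum_A
  clsign A (symdiff A C) * (clcoef x A * clcoef y (symdiff A C)).
Proof. exact: clmulE. Qed.

Let clscaleA a b x : clscale a (clscale b x) = clscale (a * b) x.
Proof. by apply/clP => A; rewrite !clbuildE mulrA. Qed.

Let clscale1 : left_id 1 clscale.
Proof. by move=> x; apply/clP => A; rewrite !clbuildE mul1r. Qed.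

Let clscaleDr : right_distributive clscale +%R.
Proof. by move=> a x y; apply/clP => A; rewrite ?clcoefD !clbuildE -mulrDr -clcoefD. Qed.

Let clscaleDl x : {morph clscale^~ x : a b / a + b}.
Proof. by move=> a b; apply/clP => A; rewrite clcoefD !clbuildE mulrDl. Qed.

HB.instance Definition _ := GRing.Zmodule_isLmodule.Build K clifford
  clscaleA clscale1 clscaleDr clscaleDl.

Lemma clcoefZ a x A : clcoef (a *: x) A = a * clcoef x A.
Proof. exact: clbuildE. Qed.

Let clscaleAl a x y : a *: (x * y) = a *: x * y.
Proof.
apply/clP => A; rewrite clcoefZ !clcoefM mulr_sumr.
by apply: eq_bigr => B _; rewrite clcoefZ mulrCA !mulrA.
Qed.

HB.instance Definition _ := GRing.Lmodule_isLalgebra.Build K clifford clscaleAl.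

Let clscaleAr a x y : a *: (x * y) = x * (a *: y).
Proof.
apply/clP => A; rewrite clcoefZ !clcoefM mulr_sumr.
by apply: eq_bigr => B _; rewrite clcoefZ mulrCA; congr (_ * _); rewrite mulrCA.
Qed.

HB.instance Definition _ := GRing.Lalgebra_isAlgebra.Build K clifford clscaleAr.

Lemma clblade0 : clblade finset.set0 = 1. Proof. by []. Qed.

Lemma clbladeM A B :
  clblade A * clblade B = clsign A B *: clblade (symdiff A B).
Proof.
apply/clP => C; rewrite [LHS]clblade_mull clcoefZ !clbuildE.
have -> : (symdiff A C == B) = (C == symdiff A B).
  by apply/eqP/eqP => [<-|->]; rewrite symdiffK.
by case: eqP => [->|_]; rewrite ?mulr0// symdiffK.
Qed.

Definition clgen (i : 'I_m) : clifford := clblade [set i]%SET.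

Lemma clgen_sqr i : clgen i * clgen i = 1.
Proof.
by rewrite clbladeM symdiffv /clsign !big_set1 ltnn expr0 scale1r.
Qed.

Lemma clgen_anticomm i j : i != j -> clgen i * clgen j = - (clgen j * clgen i).
Proof.
move=> ij; rewrite !clbladeM symdiffC -scaleNr; congr (_ *: _).
rewrite /clsign !big_set1; move: ij; rewrite -val_eqE neq_ltn.
by case/orP => lt; rewrite lt ltnNge (ltnW lt) //= expr1 expr0 opprK.
Qed.

Lemma clvec_sqr (v : 'I_m -> K) :
  (\sum_i v i *: clgen i) ^+ 2 = (\sum_i v i * v i)%:A.
Proof.
rewrite expr2 mulr_suml.
have E : forall (s : seq 'I_m), uniq s ->
   (\sum_(i <- s) v i *: clgen i) * (\sum_(i <- s) v i *: clgen i)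
   = (\sum_(i <- s) v i * v i)%:A.
  elim=> [|i s IHs] /=; first by rewrite !big_nil scale0r mulr0.
  case/andP => nis us; rewrite !big_cons mulrDl !mulrDr IHs // scalerDl.
  rewrite -scalerAl -scalerAr clgen_sqr scalerA -addrA; congr (_ + _).
  rewrite addrA -[RHS]add0r; congr (_ + _).
  rewrite mulr_sumr mulr_suml -big_split big_seq /= big1 // => j js.
  have ij : i != j by apply: contraNneq nis => ->.
  rewrite -!(scalerAl, scalerAr) (clgen_anticomm ij) !scalerA mulrC.
  by rewrite scalerN addNr.
by rewrite -mulr_suml; apply: E; rewrite index_enum_uniq.
Qed.

Lemma clbladeE A : clblade A = \prod_(i <- enum A) clgen i.
Proof.
have srt : sorted (fun i j : 'I_m => (i < j)%N) (enum A).
  rewrite /enum_mem; apply: sorted_filter; first by move=> i j k; apply: ltn_trans.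
  rewrite -enumT; have := iota_ltn_sorted 0 m.
  by rewrite -val_enum_ord sorted_map.
have {1}-> : A = [set i in enum A]%SET by apply/setP => i; rewrite inE mem_enum.
elim: (enum A) srt => [|i s IHs] srt.
  by rewrite big_nil -clblade0; congr clblade; apply/setP => i; rewrite !inE.
have is_min : forall j, j \in s -> (i < j)%N.
  by move=> j; apply/allP: j; apply: order_path_min srt => ? ? ?; apply: ltn_trans.
rewrite big_cons -IHs ?(path_sorted srt) // clbladeM.
have -> : clsign [set i]%SET [set j in s]%SET = 1.
  rewrite /clsign big_set1 big1 // => j; rewrite inE => /is_min ij.
  by rewrite ltnNge ltnW.
rewrite scale1r; congr clblade; apply/setP => j; rewrite !inE.
case: eqVneq => [->|//]; case: (boolP (i \in s)) => // /is_min.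
by rewrite ltnn.
Qed.

Lemma cl_blade_sum x : x = \sum_A clcoef x A *: clblade A.
Proof.
apply/clP => B; rewrite clcoef_sum (bigD1 B) //= big1 ?addr0 => [|A /negPf AB].
  by rewrite clcoefZ clbuildE eqxx mulr1.
by rewrite clcoefZ clbuildE eq_sym AB mulr0.
Qed.

End Clifford.

(* clifford R[i] m is the complexification of the real Clifford algebra
   clifford R m: the latter embeds in it as a real algebra through cl_complex,
   and every element is uniquely a + 'i b with a, b in the image
   (cl_complex_bij). *)
Section Complexification.
Variables (R : rcfType) (m : nat).
Local Open Scope complex_scope.

Definition cl_complex (a : clifford R m) : clifford R[i] m :=
  clbuild (fun A => (clcoef a A)%:C).

Lemma cl_complexE a A : clcoef (cl_complex a) A = (clcoef a A)%:C.
Proof. exact: clbuildE. Qed.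

Lemma cl_complexD a b : cl_complex (a + b) = cl_complex a + cl_complex b.
Proof. by apply/clP => A; rewrite clcoefD !cl_complexE clcoefD rmorphD. Qed.

Lemma cl_complexM a b : cl_complex (a * b) = cl_complex a * cl_complex b.
Proof.
apply/clP => C; rewrite clcoefM cl_complexE clcoefM rmorph_sum /=.
apply: eq_bigr => A _; rewrite !cl_complexE !rmorphM; congr (_ * _).
rewrite /clsign rmorph_prod; apply: eq_bigr => i _.
by rewrite rmorph_prod; apply: eq_bigr => j _; rewrite rmorph_sign.
Qed.

Lemma cl_complex1 : cl_complex 1 = 1.
Proof. by apply/clP => A; rewrite cl_complexE !clbuildE rmorph_nat. Qed.

Lemma cl_complexZ (r : R) a : cl_complex (r *: a) = r%:C *: cl_complex a.
Proof. by apply/clP => A; rewrite clcoefZ !cl_complexE clcoefZ rmorphM. Qed.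

Lemma cl_complex_gen i : cl_complex (clgen R i) = clgen R[i] i.
Proof. by apply/clP => A; rewrite cl_complexE !clbuildE rmorph_nat. Qed.

Lemma cl_complex_bij : bijective (fun ab : clifford R m * clifford R m =>
  cl_complex ab.1 + 'i%C *: cl_complex ab.2).
Proof.
exists (fun z => (clbuild (fun A => complex.Re (clcoef z A)),
                  clbuild (fun A => complex.Im (clcoef z A)))).
  move=> [a b]; congr pair; apply/clP => A;
  by rewrite clbuildE clcoefD clcoefZ !cl_complexE /= ?(mul0r, mulr0, mul1r, subr0, addr0, add0r).
move=> z; apply/clP => A; rewrite clcoefD clcoefZ !cl_complexE !clbuildE.
case: (clcoef z A) => a b /=; apply/eqP; rewrite eq_complex /=.
by rewrite ?(mul0r, mulr0, mul1r, subr0, addr0, add0r) !eqxx.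
Qed.

End Complexification.

Section LebesgueRn.
Variable R : realType.
Local Open Scope classical_set_scope.

Section Cons.
Variables (n : nat) (mu : {sigma_finite_measure set (n.-tuple R) -> \bar R}).

Let cons_pair (p : measurableTypeR R * n.-tuple R) : n.+1.-tuple R :=
  [tuple of p.1 :: p.2].

Let measurable_cons_pair : measurable_fun setT cons_pair.
Proof. exact: measurable_cons. Qed.

Let measurable_preimage_cons A : measurable A -> measurable (cons_pair @^-1` A).
Proof. by move=> mA; rewrite -[X in measurable X]setTI; exact: measurable_cons_pair. Qed.

Definition lebesgue_cons : set (n.+1.-tuple R) -> \bar R :=
  pushforward (lebesgue_measure \x mu)%E cons_pair.

Let lebesgue_cons0 : lebesgue_cons set0 = 0%E.
Proof. by rewrite /lebesgue_cons /pushforward preimage_set0 measure0. Qed.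

Let lebesgue_cons_ge0 A : (0 <= lebesgue_cons A)%E.
Proof. exact: measure_ge0. Qed.

Let lebesgue_cons_sigma_additive : semi_sigma_additive lebesgue_cons.
Proof.
move=> F mF tF mUF; rewrite /lebesgue_cons /pushforward preimage_bigcup.
apply: measure_semi_sigma_additive.
- by move=> i; exact: measurable_preimage_cons.
- apply/trivIsetP => /= i j _ _ ij; rewrite -preimage_setI.
  by move/trivIsetP : tF => /(_ _ _ _ _ ij) ->//; rewrite preimage_set0.
- by rewrite -preimage_bigcup; exact: measurable_preimage_cons.
Qed.

HB.instance Definition _ := isMeasure.Build _ _ _ lebesgue_cons
  lebesgue_cons0 lebesgue_cons_ge0 lebesgue_cons_sigma_additive.

Let uncons (x : n.+1.-tuple R) : measurableTypeR R * n.-tuple R :=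
  (tnth x ord0, [tuple of behead x]).

Let measurable_uncons : measurable_fun setT uncons.
Proof.
apply/measurable_fun_pair; first exact: (measurable_tnth ord0).
exact: measurable_behead.
Qed.

Let cons_pairK : cancel cons_pair uncons.
Proof. by case=> a t; congr pair; apply/val_inj. Qed.

Let lebesgue_cons_sigma_finite : sigma_finite setT lebesgue_cons.
Proof.
have /sigma_finiteP[F [FT ndF Ffin]] := sigma_finiteT (@lebesgue_measure R).
have /sigma_finiteP[G [GT ndG Gfin]] := sigma_finiteT mu.
exists (fun i => uncons @^-1` (F i `*` G i)).
  rewrite -preimage_bigcup; apply/esym/seteqP; split=> // x _.
  have : [set: R] (uncons x).1 by [].
  have : [set: n.-tuple R] (uncons x).2 by [].
  rewrite FT GT => -[j _ Gj] [i _ Fi]; exists (maxn i j) => //; split.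
  - by move: Fi; exact/subsetPset/ndF/leq_maxl.
  - by move: Gj; exact/subsetPset/ndG/leq_maxr.
move=> i; have [mF Foo] := Ffin i; have [mG Goo] := Gfin i.
split.
  rewrite -[X in measurable X]setTI; apply: measurable_uncons => //.
  exact: measurableX.
have E : cons_pair @^-1` (uncons @^-1` (F i `*` G i)) = F i `*` G i.
  rewrite -comp_preimage (_ : uncons \o cons_pair = id) ?preimage_id //.
  by apply/funext => p; apply: cons_pairK.
rewrite /lebesgue_cons /pushforward E product_measure1E//.
by rewrite lte_mul_pinfty// ge0_fin_numE.
Qed.

HB.instance Definition _ := Measure_isSigmaFinite.Build _ _ _ lebesgue_cons
  lebesgue_cons_sigma_finite.

End Cons.

(* The n-fold product of the one-dimensional Lebesgue measure, on the product
   (Borel) sigma-algebra of n.-tuple R; cf. borel_lebesgue_box. *)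
Fixpoint borel_lebesgue n : {sigma_finite_measure set (n.-tuple R) -> \bar R} :=
  match n return {sigma_finite_measure set (n.-tuple R) -> \bar R} with
  | 0 => dirac [tuple]
  | n'.+1 => lebesgue_cons (borel_lebesgue n')
  end.

Lemma borel_lebesgue_box n (A : 'I_n -> set R) :
  (forall i, measurable (A i)) ->
  borel_lebesgue n [set x | forall i, A i (tnth x i)] =
  (\prod_(i < n) lebesgue_measure (A i))%E.
Proof.
elim: n A => [|n IHn] A mA /=.
  rewrite big_ord0 diracE mem_set //; by case.
rewrite big_ord_recl /= -IHn; last by move=> i; exact: mA.
rewrite /lebesgue_cons /pushforward.
rewrite -product_measure1E; last 2 first.
- exact: mA.
- have -> : [set x : n.-tuple R | forall i, A (lift ord0 i) (tnth x i)] =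
    \bigcap_(i in [set: 'I_n]) (fun x => tnth x i) @^-1` (A (lift ord0 i)).
    by apply/seteqP; split=> [x Ax i _|x Ax i]; apply: Ax.
  apply: fin_bigcap_measurable => // i _.
  rewrite -[X in measurable X]setTI; apply: measurable_tnth => //; exact: mA.
congr (_ _); apply/seteqP; split => -[a t] /=.
  move=> At; split=> [|i]; first exact: (At ord0).
  by have := At (lift ord0 i); rewrite tnthS.
move=> [Aa At] i; case: (unliftP ord0 i) => [j ->|-> //].
by rewrite tnthS; apply: At.
Qed.

(* Completing borel_lebesgue makes every Lebesgue-measurable function admissible:
   the underlying sigma-algebra is that of the Caratheodory-measurable sets. *)
Definition lebesgue_Rn n := @completed_measure_extension _ _ R (borel_lebesgue n).

Arguments lebesgue_Rn : clear implicits.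
HB.instance Definition _ n := Measure.on (lebesgue_Rn n).

(* dm(x) = (2 pi)^(-n/2) dx *)
Definition measure_m n :=
  mscale (NngNum (powR_ge0 (2 * pi) (- (n%:R / 2)))) (lebesgue_Rn n).

Arguments measure_m : clear implicits.
HB.instance Definition _ n := Measure.on (measure_m n).

End LebesgueRn.
Arguments lebesgue_Rn : clear implicits.
Arguments measure_m : clear implicits.

(* The first n generators are e_1, ..., e_n, the last n are e'_1, ..., e'_n. *)
Notation CG R n := (clifford (complex R) (n + n)%N).

Section Transforms.
Variables (R : realType) (n : nat).
Local Notation CG := (CG R n).
Local Open Scope classical_set_scope.
Local Open Scope complex_scope.

Implicit Types (x y : n.-tuple R) (f : n.-tuple R -> CG).

Definition basis_e (k : 'I_n) : CG := clgen R[i] (lshift n k).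
Definition basis_e' (k : 'I_n) : CG := clgen R[i] (rshift n k).
Definition bivB (k : 'I_n) : CG := basis_e k * basis_e' k.

(* CG is finite-dimensional: integrability, integrals and limits are taken
   coordinatewise in the real basis (e_A, 'i e_A). *)
Definition cg_integrable f : Prop := forall A : {set 'I_(n + n)},
  (measure_m R n).-integrable setT (fun x => (complex.Re (clcoef (f x) A))%:E) /\
  (measure_m R n).-integrable setT (fun x => (complex.Im (clcoef (f x) A))%:E).

Definition cg_integral f : CG := clbuild (fun A : {set 'I_(n + n)} =>
  (\int[measure_m R n]_x complex.Re (clcoef (f x) A)) +i*
  (\int[measure_m R n]_x complex.Im (clcoef (f x) A))).

(* exp a = sum_k a^k / k! *)
Definition cg_exp (a : CG) : CG :=
  let S N := \sum_(k < N) (k`!%:R : R[i])^-1 *: a ^+ k in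
  clbuild (fun A : {set 'I_(n + n)} =>
    limn (fun N => complex.Re (clcoef (S N) A)) +i*
    limn (fun N => complex.Im (clcoef (S N) A))).

Definition dot x y : R := \sum_(k < n) tnth x k * tnth y k.

Definition II x y : CG := \sum_(k < n) (tnth x k * tnth y k)%:C *: bivB k.

Definition fourier f y : CG :=
  cg_integral (fun x => cg_exp (- ('i%C * (dot x y)%:C))%:A * f x).

Definition fourier_o f y : CG :=
  cg_integral (fun x => cg_exp (- II x y) * f x).

Definition fourier_o_right f y : CG :=
  cg_integral (fun x => f x * cg_exp (- II x y)).

Definition Mplus (k : 'I_n) : CG := 2^-1 *: (1 + 'i%C *: bivB k).
Definition Mminus (k : 'I_n) : CG := 2^-1 *: (1 - 'i%C *: bivB k).

(* s : {ffun 'I_n -> bool} stands for the sign vector ((-1)^(s k))_k of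
   {-1, 1}^n, so that s k = false is the sign +1. *)
Definition sgn_of (s : {ffun 'I_n -> bool}) (k : 'I_n) : R := (-1) ^+ s k.

Definition Ms (s : {ffun 'I_n -> bool}) : CG :=
  \prod_(k < n) (if s k then Mminus k else Mplus k).

Definition Rs (s : {ffun 'I_n -> bool}) y : n.-tuple R :=
  [tuple - (sgn_of s k * tnth y k) | k < n].

End Transforms.

(* Main.v *)
Require Import Defs.
From HB Require Import structures.
From mathcomp Require Import all_boot all_order all_algebra.
From mathcomp Require Import complex ring.
From mathcomp Require Import all_classical all_reals all_analysis.
From mathcomp Require Import measurable_realfun.
Set Implicit Arguments.
Unset Strict Implicit.
Unset Printing Implicit Defensive.
Import Order.TTheory GRing.Theory Num.Theory.
Import numFieldNormedType.Exports.
Local Open Scope ring_scope.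

(** The elements [Ms s] are orthogonal idempotents with sum 1
    ([Ms_mul], [sum_Ms]), and each of them is a simultaneous eigenvector of
    the commuting bivectors [bivB k], with eigenvalue [-i s_k] ([bivB_Ms]).
    So on [Ms s] the element [- I(x, y)] acts as the scalar
    [- i x . R_s y] ([II_Ms]), and its exponential is the combination
    [sum_s e^(- i x . R_s y) Ms s] of scalar Fourier kernels ([cg_exp_II]).
    Integrating this identity against [f] on either side expresses the
    geometric transforms through the classical one ([fourier_oE],
    [fourier_o_rightE]); the converse formulas are obtained by multiplying
    by [Ms s], which keeps a single summand ([Ms_fourier_o],
    [fourier_o_right_Ms]), and by summing over [s], the reflection [Rs s]
    being an involution.

    For the iterated transforms, [Ms s * fourier_o f] is
    [Ms s * (fourier f o Rs s)], and a second geometric transform gives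
    [Ms s * fourier (fourier f o Rs s) (Rs s y)].  The substitution
    [u = Rs s x] turns this into [Ms s * fourier (fourier f) y]
    ([fourier_Rs]), because [Rs s] is symmetric for the dot product and
    preserves the measure.  The latter is proved by induction on the dimension
    for the product measure on Borel sets ([borel_lebesgue_Rs]), and passes to
    the completion because the outer measure is determined by the measure on
    Borel sets ([mu_ext_preimage], [caratheodory_preimage]). *)

(** * Eigenvectors of the bivectors B_k *)

Section EigenProducts.
Variables (K : comNzRingType) (A : algType K) (I : eqType).
Implicit Types (r : seq I) (F : I -> A).

Lemma prod_eigen r F (c : I -> K) (m : A) : (forall j, F j * m = c j *: m) ->
  (\prod_(j <- r) F j) * m = (\prod_(j <- r) c j) *: m.
Proof.
move=> Fm; elim: r => [|j r IHr]; first by rewrite !big_nil mul1r scale1r.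
by rewrite !big_cons -mulrA IHr -scalerAr Fm scalerA mulrC.
Qed.

(** Commutation brings [x] next to the factor [F k], on which it acts as the
    scalar [c]. *)
Lemma eigen_prod r F k (c : K) (x : A) : k \in r ->
  (forall j, GRing.comm x (F j)) -> x * F k = c *: F k ->
  x * \prod_(j <- r) F j = c *: \prod_(j <- r) F j.
Proof.
move=> + xF xk; elim: r => // j r IHr; rewrite inE big_cons.
case/orP=> [/eqP<-|/IHr{}IHr].
  by rewrite mulrA xk scalerAl.
by rewrite mulrA xF -mulrA IHr scalerAr.
Qed.

End EigenProducts.

Section SpectralIdempotents.
Variables (R : realType) (n : nat).
Local Notation CG := (CG R n).
Local Open Scope complex_scope.
Implicit Types (s t : {ffun 'I_n -> bool}) (x y : n.-tuple R) (k : 'I_n).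

Lemma clgen_anticomm_comm (a b c : 'I_(n + n)) : a != b -> a != c ->
  GRing.comm (clgen R[i] a) (clgen R[i] b * clgen R[i] c).
Proof.
move=> ab ac; rewrite /GRing.comm mulrA (clgen_anticomm _ ab) mulNr.
rewrite -[in LHS]mulrA (clgen_anticomm _ ac) mulrN opprK.
by rewrite mulrA.
Qed.

Lemma bivB_sqr k : bivB R k * bivB R k = -1.
Proof.
have lr : rshift n k != lshift n k by rewrite eq_rlshift.
rewrite /bivB -mulrA (mulrA (basis_e' R k)) /basis_e /basis_e'.
rewrite (clgen_anticomm _ lr) mulNr -mulrA clgen_sqr mulr1 mulrN.
by rewrite clgen_sqr.
Qed.

(** For [j != k] each generator of [bivB j] anticommutes with both generators of
    [bivB k], and the two signs cancel. *)
Lemma bivB_comm j k : GRing.comm (bivB R j) (bivB R k).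
Proof.
have [->//|jk] := eqVneq j k.
apply/commr_sym/commrM; apply: commr_sym; apply: clgen_anticomm_comm.
- by rewrite eq_lshift.
- by rewrite eq_lrshift.
- by rewrite eq_rlshift.
- by rewrite eq_rshift.
Qed.

Definition Mfactor k (b : bool) : CG := if b then Mminus R k else Mplus R k.

Lemma MfactorE k b :
  Mfactor k b = 2^-1 *: (1 + ((-1) ^+ b * 'i%C) *: bivB R k).
Proof. by case: b; rewrite /= ?expr1 ?expr0 ?mulN1r ?mul1r ?scaleNr. Qed.

Lemma bivB_Mfactor k b :
  bivB R k * Mfactor k b = - ((-1) ^+ b * 'i%C) *: Mfactor k b.
Proof.
rewrite MfactorE -scalerAr [RHS]scalerA [in RHS]mulrC -[RHS]scalerA.
congr (_ *: _).
rewrite mulrDr mulr1 -scalerAr bivB_sqr scalerDr scalerA scalerN scaleNr.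
have -> : - ((-1) ^+ b * 'i%C) * ((-1) ^+ b * 'i%C) = 1 :> R[i].
  by rewrite mulNr mulrACA -signr_addb addbb mul1r -expr2 sqr_i opprK.
by rewrite scale1r addrC.
Qed.

Lemma bivB_comm_Mfactor j k b : GRing.comm (bivB R j) (Mfactor k b).
Proof.
rewrite MfactorE /GRing.comm -scalerAr -scalerAl mulrDr mulrDl mulr1 mul1r.
by rewrite -scalerAr -scalerAl (bivB_comm j k).
Qed.

Lemma Mfactor_comm j b k b' : GRing.comm (Mfactor j b) (Mfactor k b').
Proof.
rewrite [Mfactor j b]MfactorE /GRing.comm -scalerAr -scalerAl.
rewrite mulrDr mulrDl mulr1 mul1r -scalerAr -scalerAl.
by rewrite (bivB_comm_Mfactor j k b').
Qed.

Lemma Mfactor_mul k b b' :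
  Mfactor k b * Mfactor k b' = (b == b')%:R *: Mfactor k b'.
Proof.
rewrite [Mfactor k b]MfactorE -scalerAl mulrDl mul1r -scalerAl bivB_Mfactor.
rewrite scalerA -[X in X + _]scale1r -scalerDl scalerA; congr (_ *: _).
rewrite mulrN mulrACA -signr_addb -expr2 sqr_i mulrN1 opprK.
case: b b' => -[] /=; rewrite ?expr0 ?expr1 ?subrr ?mulr0 //.
  by rewrite mulVf // pnatr_eq0.
by rewrite mulVf // pnatr_eq0.
Qed.

Lemma MsE s : Ms R s = \prod_(k < n) Mfactor k (s k).
Proof. by []. Qed.

(** Expanding [prod_k (Mplus k + Mminus k)], a product of ones. *)
Lemma sum_Ms : \sum_(s : {ffun 'I_n -> bool}) Ms R s = 1.
Proof.
rewrite -(bigA_distr_bigA (fun k b => Mfactor k b)) big1 // => k _.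
rewrite big_bool /= /Mminus /Mplus -scalerDr addrACA addNr addr0.
rewrite -[X in _ *: (X + _)]scale1r -[X in _ *: (_ + X)]scale1r -scalerDl.
by rewrite scalerA mulVf ?scale1r // pnatr_eq0.
Qed.

(** Each factor of [Ms s] acts on [Ms t] through the factor of [Ms t] with the
    same index: as the identity if the signs agree, as zero otherwise. *)
Lemma Ms_mul s t : Ms R s * Ms R t = (s == t)%:R *: Ms R t.
Proof.
rewrite (MsE s) (@prod_eigen _ _ _ _ _ (fun k => (s k == t k)%:R)); last first.
  move=> k; apply: (eigen_prod (mem_index_enum k)) => [j|].
    exact: Mfactor_comm.
  exact: Mfactor_mul.
congr (_ *: _); have [->|st] := eqVneq s t.
  by rewrite big1 // => k _; rewrite eqxx.
have [k stk] : exists k, s k != t k.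
  apply/existsP; rewrite -negb_forall; apply: contraNN st => /forallP st.
  by apply/eqP/ffunP => k; apply/eqP.
by rewrite (bigD1 k) //= (negbTE stk) mul0r.
Qed.

Lemma bivB_Ms k s : bivB R k * Ms R s = - ((-1) ^+ s k * 'i%C) *: Ms R s.
Proof.
apply: (eigen_prod (mem_index_enum k)) => [j|]; first exact: bivB_comm_Mfactor.
exact: bivB_Mfactor.
Qed.

Lemma RsK s : involutive (@Rs R n s).
Proof.
move=> y; apply: eq_from_tnth => k; rewrite !tnth_mktuple /sgn_of.
by rewrite mulrN opprK mulrA -signr_addb addbb mul1r.
Qed.

Lemma dot_Rs s x y : dot x (Rs s y) = dot (Rs s x) y.
Proof.
apply: eq_bigr => k _; rewrite !tnth_mktuple mulrN mulNr.
by rewrite mulrCA mulrA.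
Qed.

(** The eigenvalue [-i s_k] of [bivB k] is linear in [s_k], so [Ms s] turns
    [I(x, y)] into [i] times a dot product with the signs absorbed by [Rs]. *)
Lemma II_Ms s x y :
  - II x y * Ms R s = (- ('i%C * (dot x (Rs s y))%:C)) *: Ms R s.
Proof.
rewrite /II /dot mulNr mulr_suml rmorph_sum mulr_sumr scaleNr; congr (- _).
rewrite scaler_suml; apply: eq_bigr => k _.
rewrite -scalerAl bivB_Ms scalerA; congr (_ *: _).
rewrite tnth_mktuple /sgn_of mulrN !rmorphM rmorphN rmorphM rmorph_sign.
ring.
Qed.

End SpectralIdempotents.

(** * Exponentials of elements with imaginary eigenvalues *)

Section Exponential.
Variables (R : realType) (n : nat).
Local Notation CG := (CG R n).
Local Open Scope classical_set_scope.
Local Open Scope complex_scope.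
Implicit Types (t : R) (z w : R[i]).

(** The complex exponential [e^(- i t)]. *)
Definition cis_neg t : R[i] := cos t +i* - sin t.

Lemma exp_term_cis_neg t k :
  (k`!%:R : R[i])^-1 * (- ('i%C * t%:C)) ^+ k =
  cos_coeff t k +i* - sin_coeff t k.
Proof.
(* even powers are real; an odd power has one more factor - 'i t *)
have sq m : (- ('i%C * t%:C)) ^+ m.*2 = ((-1 : R) ^+ m * t ^+ m.*2)%:C.
  rewrite -muln2 mulnC !exprM sqrrN [(_ * _) ^+ 2]exprMn sqr_i exprMn.
  by rewrite rmorphM !rmorphXn rmorphN1.
have -> : (k`!%:R : R[i])^-1 = (k`!%:R^-1)%:C by rewrite fmorphV rmorph_nat.
apply/eqP; rewrite eq_complex -[k]odd_double_half; case: (odd k).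
  rewrite add1n exprS sq /cos_coeff /sin_coeff /= odd_double doubleK exprS.
  move: (_^-1) (_ ^+ _) ((-1 : R) ^+ _) (_ ^ _) => c u v w.
  by apply/andP; split; apply/eqP => /=; ring.
rewrite add0n sq /cos_coeff /sin_coeff /= odd_double doubleK -exprnP.
move: (_^-1) (t ^+ _) ((-1 : R) ^+ k./2) ((-1) ^+ _) => c u v w.
by apply/andP; split; apply/eqP => /=; ring.
Qed.

Lemma cRe_sum (I : Type) (r : seq I) (F : I -> R[i]) :
  complex.Re (\sum_(i <- r) F i) = \sum_(i <- r) complex.Re (F i).
Proof. exact: (raddf_sum (@complex.Re R)). Qed.

Lemma cIm_sum (I : Type) (r : seq I) (F : I -> R[i]) :
  complex.Im (\sum_(i <- r) F i) = \sum_(i <- r) complex.Im (F i).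
Proof. exact: (raddf_sum (@complex.Im R)). Qed.

Lemma cReD z w : complex.Re (z + w) = complex.Re z + complex.Re w.
Proof. by case: z w => [a b] [c d]. Qed.

Lemma cImD z w : complex.Im (z + w) = complex.Im z + complex.Im w.
Proof. by case: z w => [a b] [c d]. Qed.

Lemma cReM z w : complex.Re (z * w) =
  complex.Re z * complex.Re w - complex.Im z * complex.Im w.
Proof. by case: z w => [a b] [c d]. Qed.

Lemma cImM z w : complex.Im (z * w) =
  complex.Re z * complex.Im w + complex.Im z * complex.Re w.
Proof. by case: z w => [a b] [c d]. Qed.

Lemma exp_partial_sum_cis_neg t N :
  \sum_(k < N) (k`!%:R : R[i])^-1 * (- ('i%C * t%:C)) ^+ k =
  series (cos_coeff t) N +i* - series (sin_coeff t) N.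
Proof.
rewrite (eq_bigr _ (fun (k : 'I_N) _ => exp_term_cis_neg t k)).
apply/eqP; rewrite eq_complex cRe_sum cIm_sum /series /= !big_mkord sumrN.
by rewrite !eqxx.
Qed.

(** Decomposing 1 into the eigenvectors [M i] of [a] diagonalises every power of
    [a], so the partial sums of [cg_exp a] are combinations of the [M i] whose
    coefficients are the partial sums of the exponential series of
    [- i t_i]. *)
Lemma cg_exp_eigen (I : finType) (M : I -> CG) (t : I -> R) (a : CG) :
  \sum_i M i = 1 -> (forall i, a * M i = (- ('i%C * (t i)%:C)) *: M i) ->
  cg_exp a = \sum_i cis_neg (t i) *: M i.
Proof.
move=> M1 aM.
pose z N i : R[i] :=
  series (cos_coeff (t i)) N +i* - series (sin_coeff (t i)) N.
have aXM k i : a ^+ k * M i = (- ('i%C * (t i)%:C)) ^+ k *: M i.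
  elim: k => [|k IHk]; first by rewrite !expr0 mul1r scale1r.
  by rewrite exprS -mulrA IHk -scalerAr aM scalerA exprSr.
have SE N A : clcoef (\sum_(k < N) (k`!%:R : R[i])^-1 *: a ^+ k) A =
    \sum_i z N i * clcoef (M i) A.
  transitivity (clcoef (\sum_i z N i *: M i) A); last first.
    by rewrite clcoef_sum; apply: eq_bigr => i _; rewrite clcoefZ.
  congr clcoef.
  under [RHS]eq_bigr do rewrite /z -exp_partial_sum_cis_neg scaler_suml.
  rewrite exchange_big /=; apply: eq_bigr => k _.
  rewrite -[a ^+ k]mulr1 -M1 mulr_sumr scaler_sumr; apply: eq_bigr => i _.
  by rewrite aXM scalerA.
have cvgc i : (fun N => series (cos_coeff (t i)) N) @ \oo --> cos (t i).
  by rewrite cos.unlock; exact: is_cvg_series_cos_coeff.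
have cvgs i : (fun N => series (sin_coeff (t i)) N) @ \oo --> sin (t i).
  by rewrite sin.unlock; exact: is_cvg_series_sin_coeff.
apply/clP => A; rewrite clbuildE clcoef_sum.
under [RHS]eq_bigr do rewrite clcoefZ.
apply/eqP; rewrite eq_complex cRe_sum cIm_sum.
apply/andP; split; apply/eqP => /=.
- apply/cvg_lim => //; under eq_cvg do rewrite SE cRe_sum.
  apply: cvg_big => [|i _]; first exact: add_continuous.
  under eq_cvg do rewrite cReM /=.
  rewrite cReM /=; apply: cvgB; apply: cvgMr_tmp.
    exact: cvgc.
  by apply: cvgN; exact: cvgs.
- apply/cvg_lim => //; under eq_cvg do rewrite SE cIm_sum.
  apply: cvg_big => [|i _]; first exact: add_continuous.
  under eq_cvg do rewrite cImM /=.
  rewrite cImM /=; apply: cvgD; apply: cvgMr_tmp.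
    exact: cvgc.
  by apply: cvgN; exact: cvgs.
Qed.

End Exponential.

(** * Complex and Clifford-valued integrals *)

Section ComplexIntegral.
Local Open Scope classical_set_scope.
Local Open Scope complex_scope.
Context d (T : measurableType d) (R : realType).
Variable mu : {measure set T -> \bar R}.
Implicit Types (f g : T -> R) (h : T -> R[i]).

Lemma integrable_lincomb (a b : R) f g :
  mu.-integrable setT (EFin \o f) -> mu.-integrable setT (EFin \o g) ->
  mu.-integrable setT (EFin \o (fun x => a * f x + b * g x)).
Proof.
move=> fi gi; have := integrableD measurableT (integrableZl measurableT a fi)
  (integrableZl measurableT b gi).
by apply: eq_integrable => // x _; rewrite /= EFinD !EFinM.
Qed.

Lemma Rintegral_lincomb (a b : R) f g :
  mu.-integrable setT (EFin \o f) -> mu.-integrable setT (EFin \o g) ->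
  \int[mu]_x (a * f x + b * g x) = a * \int[mu]_x f x + b * \int[mu]_x g x.
Proof.
move=> fi gi; rewrite RintegralD //; first by rewrite !RintegralZl.
- by have := integrableZl measurableT a fi; apply: eq_integrable.
- by have := integrableZl measurableT b gi; apply: eq_integrable.
Qed.

Definition cintegrable h : Prop :=
  mu.-integrable setT (EFin \o (@complex.Re R \o h)) /\
  mu.-integrable setT (EFin \o (@complex.Im R \o h)).

Definition cintegral h : R[i] :=
  (\int[mu]_x complex.Re (h x)) +i* (\int[mu]_x complex.Im (h x)).

Lemma cintegrable0 : cintegrable (fun=> 0).
Proof. by split; exact: (integrable0 mu setT). Qed.

Lemma cintegral0 : cintegral (fun=> 0) = 0.
Proof. by rewrite /cintegral /= Rintegral_cst // mul0r. Qed.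

Lemma cintegrableZD (c : R[i]) h1 h2 : cintegrable h1 -> cintegrable h2 ->
  cintegrable (fun x => c * h1 x + h2 x).
Proof.
move=> [r1 i1] [r2 i2]; split.
- have := integrable_lincomb 1 1
    (integrable_lincomb (complex.Re c) (- complex.Im c) r1 i1) r2.
  apply: eq_integrable => // x _ /=.
  by rewrite !mul1r mulNr cReD cReM.
- have := integrable_lincomb 1 1
    (integrable_lincomb (complex.Re c) (complex.Im c) i1 r1) i2.
  apply: eq_integrable => // x _ /=.
  by rewrite !mul1r cImD cImM.
Qed.

Lemma cintegralZD (c : R[i]) h1 h2 : cintegrable h1 -> cintegrable h2 ->
  cintegral (fun x => c * h1 x + h2 x) = c * cintegral h1 + cintegral h2.
Proof.
move=> [r1 i1] [r2 i2].
apply/eqP; rewrite eq_complex cReD cImD cReM cImM /=.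
apply/andP; split; apply/eqP.
- rewrite -mulNr -(Rintegral_lincomb _ _ r1 i1).
  rewrite -[X in X + _]mul1r -[X in _ + X]mul1r.
  rewrite -Rintegral_lincomb //; last exact: integrable_lincomb.
  by apply: eq_Rintegral => x _; rewrite cReD cReM !mul1r mulNr.
- rewrite -(Rintegral_lincomb _ _ i1 r1) -[X in X + _]mul1r -[X in _ + X]mul1r.
  rewrite -Rintegral_lincomb //; last exact: integrable_lincomb.
  by apply: eq_Rintegral => x _; rewrite cImD cImM !mul1r.
Qed.

Lemma cintegral_sum (J : Type) (r : seq J) (c : J -> R[i])
    (h : J -> T -> R[i]) :
  (forall j, cintegrable (h j)) ->
  cintegrable (fun x => \sum_(j <- r) c j * h j x) /\
  cintegral (fun x => \sum_(j <- r) c j * h j x) =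
  \sum_(j <- r) c j * cintegral (h j).
Proof.
move=> hi; elim: r => [|j r [IHi IHe]].
  under eq_fun do rewrite big_nil; rewrite big_nil cintegral0.
  by split=> //; exact: cintegrable0.
under eq_fun do rewrite big_cons; rewrite big_cons -IHe.
by split; [exact: cintegrableZD|exact: cintegralZD].
Qed.

Lemma cintegrable_bounded_mul (u h : T -> R[i]) :
  measurable_fun setT (@complex.Re R \o u) ->
  measurable_fun setT (@complex.Im R \o u) ->
  (forall x, `|complex.Re (u x)| <= 1) ->
  (forall x, `|complex.Im (u x)| <= 1) ->
  cintegrable h -> cintegrable (fun x => u x * h x).
Proof.
move=> mr mi br bi [hr hi].
have key (v f : T -> R) : measurable_fun setT v -> (forall x, `|v x| <= 1) ->
    mu.-integrable setT (EFin \o f) ->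
    mu.-integrable setT (EFin \o (fun x => v x * f x)).
  move=> mv bv fi; have : [bounded v x | x in [set: T]].
    by exists 1; split=> // M M1 x _ /=; apply: le_trans (bv x) (ltW M1).
  move=> /(integrableMr measurableT mv)/(_ fi).
  by apply: eq_integrable => // x _; rewrite /= EFinM.
split.
- have := integrable_lincomb 1 (- 1) (key _ _ mr br hr) (key _ _ mi bi hi).
  by apply: eq_integrable => // x _; rewrite /= cReM mul1r mulN1r.
- have := integrable_lincomb 1 1 (key _ _ mr br hi) (key _ _ mi bi hr).
  by apply: eq_integrable => // x _; rewrite /= cImM !mul1r.
Qed.

End ComplexIntegral.

Section CliffordIntegral.
Variables (R : realType) (n : nat).
Local Notation CG := (CG R n).
Local Open Scope classical_set_scope.
Local Open Scope complex_scope.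
Local Notation mu := (measure_m R n).
Implicit Types f g : n.-tuple R -> CG.

Lemma cg_integrableE f :
  cg_integrable f <-> forall A, cintegrable mu (fun x => clcoef (f x) A).
Proof. by []. Qed.

Lemma cg_integralE f A :
  clcoef (cg_integral f) A = cintegral mu (fun x => clcoef (f x) A).
Proof. by rewrite clbuildE. Qed.

(** In coordinates a linear map is given by finitely many complex constants, so
    it commutes with the integral by linearity of the complex integral. *)
Lemma cg_integral_linear (L : CG -> CG) f : linear L -> cg_integrable f ->
  cg_integrable (L \o f) /\ cg_integral (L \o f) = L (cg_integral f).
Proof.
move=> linL; pose L' : {linear CG -> CG} :=
  HB.pack L (GRing.isLinear.Build _ _ _ _ L linL).
rewrite -[L]/(L' : CG -> CG) => /cg_integrableE fi.
have LE z C : clcoef (L' z) C =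
    \sum_A clcoef (L' (clblade _ A)) C * clcoef z A.
  rewrite [z in LHS]cl_blade_sum linear_sum clcoef_sum.
  by apply: eq_bigr => A _; rewrite linearZ clcoefZ mulrC.
have LfE C : (fun x => clcoef ((L' \o f) x) C) =
    fun x => \sum_A clcoef (L' (clblade _ A)) C * clcoef (f x) A.
  by apply/funext => x; rewrite LE.
split.
  by apply/cg_integrableE => C; rewrite LfE; have [] := cintegral_sum
    (index_enum _) (fun A => clcoef (L' (clblade _ A)) C) fi.
apply/clP => C; rewrite cg_integralE LfE LE.
have [_ ->] := cintegral_sum
    (index_enum _) (fun A => clcoef (L' (clblade _ A)) C) fi.
by apply: eq_bigr => A _; rewrite cg_integralE.
Qed.

Lemma cg_integral_sum (J : finType) (F : J -> n.-tuple R -> CG) :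
  (forall j, cg_integrable (F j)) ->
  cg_integral (fun x => \sum_j F j x) = \sum_j cg_integral (F j).
Proof.
move=> Fi; apply/clP => A; rewrite cg_integralE clcoef_sum.
have FiA j : cintegrable mu (fun x => clcoef (F j x) A).
  by move/cg_integrableE: (Fi j); apply.
have [_] := cintegral_sum (index_enum J) (fun=> 1) FiA.
under eq_bigr do rewrite mul1r -cg_integralE.
move=> <-; congr cintegral; apply/funext => x; rewrite clcoef_sum.
by apply: eq_bigr => j _; rewrite mul1r.
Qed.

End CliffordIntegral.

(** * Reflections preserve the measure *)

Section MeasurePreserving.
Local Open Scope classical_set_scope.

Definition measure_preserving d (T : measurableType d) (R : realType)
    (mu : set T -> \bar R) (phi : T -> T) : Prop :=
  measurable_fun setT phi /\
  forall A, measurable A -> mu (phi @^-1` A) = mu A.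

Context d (T : measurableType d) (R : realType).
Variables (mu : {measure set T -> \bar R}) (phi : T -> T).
Hypothesis phiP : measure_preserving mu phi.

Lemma ge0_integral_comp (f : T -> \bar R) : measurable_fun setT f ->
  (forall x, 0 <= f x)%E -> (\int[mu]_x f (phi x) = \int[mu]_x f x)%E.
Proof.
have [mphi pres] := phiP => mf f0.
rewrite -[LHS](@ge0_integral_pushforward _ _ _ _ _ _ mphi mu setT f) //.
by apply: eq_measure_integral => // A mA _; exact: pres.
Qed.

Lemma integrable_comp (f : T -> \bar R) :
  mu.-integrable setT f -> mu.-integrable setT (f \o phi).
Proof.
have [mphi pres] := phiP => /integrableP[mf foo]; apply/integrableP; split.
  exact: measurableT_comp.
rewrite (ge0_integral_comp (f := fun x => `|f x|%E)) //.
exact: measurableT_comp.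
Qed.

Lemma Rintegral_comp (f : T -> R) : mu.-integrable setT (EFin \o f) ->
  \int[mu]_x f (phi x) = \int[mu]_x f x.
Proof.
have [mphi pres] := phiP => fi; rewrite /Rintegral; congr fine.
have mf := measurable_int mu fi.
rewrite -[LHS](@integral_pushforward _ _ _ _ _ _ mphi mu setT (EFin \o f)) //.
  by apply: eq_measure_integral => // A mA _; exact: pres.
exact: integrable_comp.
Qed.

End MeasurePreserving.

Section Completion.
Local Open Scope classical_set_scope.
Context d (T : measurableType d) (R : realType).
Variables (mu : {measure set T -> \bar R}) (phi : T -> T).
Hypotheses (phiP : measure_preserving mu phi) (phiK : involutive phi).
Local Notation cara := (caratheodory_type (mu^*)%mu).

Lemma involutive_preimageK (A : set T) : phi @^-1` (phi @^-1` A) = A.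
Proof. by apply/seteqP; split => x; rewrite /preimage /= phiK. Qed.

(** The preimage by [phi] of a countable measurable cover of [A] is one of the
    preimage of [A], with the same total measure; as [phi] is an involution, the
    resulting inequality is an equality. *)
Lemma mu_ext_preimage (A : set T) : (mu^* (phi @^-1` A) = mu^* A)%mu.
Proof.
have [mphi pres] := phiP.
have le B : (mu^*%mu (phi @^-1` B) <= mu^*%mu B)%E.
  apply: le_ereal_inf_tmp => _ [F [mF BF] <-]; apply: ereal_inf_lbound.
  exists (fun k => phi @^-1` F k).
    split=> [k|]; last by rewrite -preimage_bigcup => x /BF.
    by rewrite -[X in measurable X]setTI; exact: mphi.
  by apply: eq_eseriesr => k _; exact: pres.
by apply/eqP; rewrite eq_le le /= -{1}[A]involutive_preimageK le.
Qed.

(** Cutting [X] along the preimage of [A] is cutting the preimage of [X] along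
    [A], up to an application of [phi], which the outer measure ignores. *)
Lemma caratheodory_preimage (A : set T) : ((mu^*)%mu).-caratheodory A ->
  ((mu^*)%mu).-caratheodory (phi @^-1` A).
Proof.
move=> mA X; rewrite -[X in LHS]involutive_preimageK mu_ext_preimage mA.
rewrite -[X in X + _]mu_ext_preimage -[X in _ + X]mu_ext_preimage.
by rewrite !preimage_setI involutive_preimageK preimage_setC.
Qed.

Lemma completed_measure_preserving :
  @measure_preserving _ cara R (@completed_measure_extension _ _ R mu) phi.
Proof.
split=> [_ A mA|A mA]; last exact: mu_ext_preimage.
by rewrite setTI; exact: caratheodory_preimage.
Qed.

Lemma measurable_completed d' (U : measurableType d') (f : T -> U) :
  measurable_fun setT f -> measurable_fun setT (f : cara -> U).
Proof.
move=> mf _ A mA; rewrite setTI; apply: sub_caratheodory.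
by apply: sub_sigma_algebra; rewrite -[X in measurable X]setTI; exact: mf.
Qed.

End Completion.

Section Reflection.
Local Open Scope classical_set_scope.
Variable R : realType.

Lemma measurable_Rs n (s : {ffun 'I_n -> bool}) :
  measurable_fun setT (@Rs R n s).
Proof.
apply/measurable_fun_tnthP => k.
have -> : (@tnth _ _)^~ k \o Rs s =
    fun x : n.-tuple R => - (sgn_of R s k * tnth x k).
  by apply/funext => x; rewrite /= tnth_mktuple.
apply: measurableT_comp => //; apply: measurable_funM => //.
exact: measurable_tnth.
Qed.

Lemma lebesgue_sign_preserving (c : bool) :
  @measure_preserving _ (measurableTypeR R) R lebesgue_measure
    (fun a => - ((-1) ^+ c * a)).
Proof.
case: c => /=.
  have -> : (fun a : R => - ((-1) ^+ true * a)) = id.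
    by apply/funext => a; rewrite expr1 mulN1r opprK.
  by split=> //; exact: measurable_id.
have -> : (fun a : R => - ((-1) ^+ false * a)) = -%R.
  by apply/funext => a; rewrite expr0 mul1r.
by split=> // A mA; exact: lebesgue_measureN.
Qed.

(** Slicing along the first coordinate: the slice at [a] of the preimage of [A]
    is the preimage, by the reflection of the remaining coordinates, of a slice
    of [A] at [a] or [- a]; the induction hypothesis gives its measure, and the
    sign of [a] is removed by the reflection invariance of Lebesgue measure on
    the line. *)
Lemma borel_lebesgue_Rs n (s : {ffun 'I_n -> bool}) :
  measure_preserving (borel_lebesgue R n) (@Rs R n s).
Proof.
split; first exact: measurable_Rs.
elim: n s => [|n IHn] s A mA.
  congr (_ _); apply/funext => x; congr (A _).
  by rewrite [LHS]tuple0 [RHS]tuple0.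
pose s' := [ffun k => s (lift ord0 k)].
have [mS preS] := lebesgue_sign_preserving (s ord0).
set sg := (fun a : R => _) in mS preS.
pose c (p : measurableTypeR R * n.-tuple R) : n.+1.-tuple R :=
  [tuple of p.1 :: p.2].
have mc : measurable_fun setT c by exact: measurable_cons.
have mcA : measurable (c @^-1` A).
  by rewrite -[X in measurable X]setTI; exact: mc.
change ((lebesgue_measure \x borel_lebesgue R n) (c @^-1` (Rs s @^-1` A)) =
  (lebesgue_measure \x borel_lebesgue R n) (c @^-1` A))%E.
rewrite /product_measure1 /=.
have secE a : xsection (c @^-1` (Rs s @^-1` A)) a =
    Rs s' @^-1` xsection (c @^-1` A) (sg a).
  apply/funext => t; rewrite /xsection /= /preimage /=; apply/propext.
  rewrite !inE /=; suff -> : Rs s (c (a, t)) = c (sg a, Rs s' t) by [].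
  apply: eq_from_tnth => k; rewrite tnth_mktuple.
  case: (unliftP ord0 k) => [j ->|->]; last by rewrite /sgn_of.
  by rewrite !tnthS tnth_mktuple /sgn_of ffunE.
under eq_integral => a _.
  rewrite /= secE IHn; last exact: measurable_xsection mcA.
  over.
rewrite -[RHS](ge0_integral_comp (lebesgue_sign_preserving (s ord0))) //.
exact: measurable_fun_xsection.
Qed.

Lemma measure_m_Rs n (s : {ffun 'I_n -> bool}) :
  measure_preserving (measure_m R n) (@Rs R n s).
Proof.
have [mphi pres] :=
  completed_measure_preserving (borel_lebesgue_Rs s) (@RsK R n s).
split=> // A mA; rewrite /measure_m /mscale /lebesgue_Rn /=.
by congr (_ * _)%E; exact: pres.
Qed.

End Reflection.

(** * Relations between the transforms *)

Section TransformRelations.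
Variables (R : realType) (n : nat).
Local Notation CG := (CG R n).
Local Open Scope classical_set_scope.
Local Open Scope complex_scope.
Local Notation mu := (measure_m R n).
Implicit Types (f g : n.-tuple R -> CG) (x y : n.-tuple R).
Implicit Types s : {ffun 'I_n -> bool}.

Lemma mull_linear (m : CG) : linear (fun z : CG => m * z).
Proof. by move=> a u v; rewrite mulrDr scalerAr. Qed.

Lemma mulr_linear (m : CG) : linear (fun z : CG => z * m).
Proof. by move=> a u v; rewrite mulrDl scalerAl. Qed.

Lemma cg_exp_dot x y :
  cg_exp (- ('i%C * (dot x y)%:C))%:A = (cis_neg (dot x y))%:A :> CG.
Proof.
rewrite (@cg_exp_eigen R n unit (fun=> 1) (fun=> dot x y))
  ?big_const ?card_unit //=.
- by rewrite addr0.
- by rewrite addr0.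
- by move=> _; rewrite mulr1.
Qed.

Lemma cg_exp_II x y :
  cg_exp (- II x y) = \sum_s cis_neg (dot x (Rs s y)) *: Ms R s.
Proof. by apply: cg_exp_eigen => [|s]; [exact: sum_Ms|exact: II_Ms]. Qed.

Lemma fourierE f y :
  fourier f y = cg_integral (fun x => cis_neg (dot x y) *: f x).
Proof.
congr cg_integral; apply/funext => x.
by rewrite cg_exp_dot -scalerAl mul1r.
Qed.

Lemma measurable_dot y : measurable_fun setT (fun x => dot x y).
Proof.
apply: measurable_sum => k; apply: measurable_funM => //.
exact: measurable_tnth.
Qed.

(** The kernel is measurable, being continuous in [dot x y], and bounded. *)
Lemma cg_integrable_cis f y : cg_integrable f ->
  cg_integrable (fun x => cis_neg (dot x y) *: f x).
Proof.
move=> /cg_integrableE fi; apply/cg_integrableE => A.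
under eq_fun do rewrite clcoefZ.
have mcomp (h : R -> R) : continuous h ->
    measurable_fun setT (fun x : n.-tuple R => h (dot x y)).
  move=> ch; apply: measurableT_comp (measurable_dot y).
  exact: continuous_measurable_fun.
have mcos := measurable_completed (mu := borel_lebesgue R n)
  (mcomp _ (@continuous_cos R)).
have msin := measurable_completed (mu := borel_lebesgue R n)
  (mcomp _ (@continuous_sin R)).
apply: cintegrable_bounded_mul => [||x|x|]; last exact: fi.
- exact: mcos.
- exact: measurableT_comp msin.
- exact: cos_max.
- by rewrite /= normrN sin_max.
Qed.

(** The kernel is scalar, so a linear map can be taken out of the integral. *)
Lemma fourier_linear (L : CG -> CG) f y : linear L -> cg_integrable f ->
  fourier (L \o f) y = L (fourier f y).
Proof.
move=> linL fi; rewrite !fourierE.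
have [_ <-] := cg_integral_linear linL (cg_integrable_cis y fi).
congr cg_integral; apply/funext => x /=.
pose L' : {linear CG -> CG} := HB.pack L (GRing.isLinear.Build _ _ _ _ L linL).
by rewrite -[L]/(L' : CG -> CG) linearZ.
Qed.

Lemma fourier_oE f y : cg_integrable f ->
  fourier_o f y = \sum_s Ms R s * fourier f (Rs s y).
Proof.
move=> fi; pose F s x := Ms R s * (cis_neg (dot x (Rs s y)) *: f x).
have FP s : cg_integrable (F s) /\
    cg_integral (F s) = Ms R s * fourier f (Rs s y).
  rewrite fourierE.
  exact: cg_integral_linear (mull_linear _) (cg_integrable_cis _ fi).
rewrite -(eq_bigr _ (fun s _ => (FP s).2)) -cg_integral_sum; last first.
  by move=> s; have [] := FP s.
congr cg_integral; apply/funext => x; rewrite cg_exp_II mulr_suml.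
by apply: eq_bigr => s _; rewrite /F -scalerAl -scalerAr.
Qed.

Lemma fourier_o_rightE f y : cg_integrable f ->
  fourier_o_right f y = \sum_s fourier f (Rs s y) * Ms R s.
Proof.
move=> fi; pose F s x := (cis_neg (dot x (Rs s y)) *: f x) * Ms R s.
have FP s : cg_integrable (F s) /\
    cg_integral (F s) = fourier f (Rs s y) * Ms R s.
  rewrite fourierE.
  exact: cg_integral_linear (mulr_linear _) (cg_integrable_cis _ fi).
rewrite -(eq_bigr _ (fun s _ => (FP s).2)) -cg_integral_sum; last first.
  by move=> s; have [] := FP s.
congr cg_integral; apply/funext => x; rewrite cg_exp_II mulr_sumr.
by apply: eq_bigr => s _; rewrite /F -scalerAl -scalerAr.
Qed.

Lemma Ms_fourier_o s f y : cg_integrable f ->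
  Ms R s * fourier_o f y = Ms R s * fourier f (Rs s y).
Proof.
move=> fi; rewrite fourier_oE // mulr_sumr (bigD1 s) //= big1 => [|t ts].
  by rewrite addr0 mulrA Ms_mul eqxx scale1r.
by rewrite mulrA Ms_mul eq_sym (negbTE ts) scale0r mul0r.
Qed.

Lemma fourier_o_right_Ms s f y : cg_integrable f ->
  fourier_o_right f y * Ms R s = fourier f (Rs s y) * Ms R s.
Proof.
move=> fi; rewrite fourier_o_rightE // mulr_suml (bigD1 s) //= big1 => [|t ts].
  by rewrite addr0 -mulrA Ms_mul eqxx scale1r.
by rewrite -mulrA Ms_mul (negbTE ts) scale0r mulr0.
Qed.

Lemma cg_integral_Rs s f : cg_integrable f ->
  cg_integrable (f \o Rs s) /\ cg_integral (f \o Rs s) = cg_integral f.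
Proof.
move=> /cg_integrableE fi; have pres := measure_m_Rs R s; split.
  apply/cg_integrableE => A; have [ri ii] := fi A.
  by split; [exact: (integrable_comp pres ri)|exact: (integrable_comp pres ii)].
apply/clP => A; rewrite !cg_integralE; have [ri ii] := fi A.
congr (_ +i* _); first exact: (Rintegral_comp pres ri).
exact: (Rintegral_comp pres ii).
Qed.

(** The substitution [u = Rs s x], with [x . R_s y = R_s x . y]. *)
Lemma fourier_Rs s f y : cg_integrable f ->
  fourier (f \o Rs s) (Rs s y) = fourier f y.
Proof.
move=> fi; rewrite !fourierE.
have [_ <-] := cg_integral_Rs s (cg_integrable_cis y fi).
by congr cg_integral; apply/funext => x /=; rewrite dot_Rs.
Qed.

Lemma fourier_fourier f y : cg_integrable f ->
  cg_integrable (fourier f) -> cg_integrable (fourier_o f) ->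
  fourier (fourier f) y = fourier_o (fourier_o f) y.
Proof.
move=> fi Fi Foi; rewrite fourier_oE // -[LHS]mul1r -sum_Ms mulr_suml.
apply: eq_bigr => s _.
rewrite -[RHS](fourier_linear (Rs s y) (mull_linear (Ms R s)) Foi).
have -> : (fun z => Ms R s * z) \o fourier_o f =
    (fun z => Ms R s * z) \o (fourier f \o Rs s).
  by apply/funext => x; exact: Ms_fourier_o.
have [FRi _] := cg_integral_Rs s Fi.
rewrite [RHS](fourier_linear (Rs s y) (mull_linear (Ms R s)) FRi).
by rewrite [X in _ = _ * X](fourier_Rs s y Fi).
Qed.

End TransformRelations.

Theorem mainTheorem5 (R : realType) (n : nat) (f : n.-tuple R -> CG R n) :
  cg_integrable f ->
  (forall y : n.-tuple R,
    [/\ fourier f y =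
          \sum_(s : {ffun 'I_n -> bool}) Ms R s * fourier_o f (Rs s y),
        fourier_o f y =
          \sum_(s : {ffun 'I_n -> bool}) Ms R s * fourier f (Rs s y),
        fourier f y =
          \sum_(s : {ffun 'I_n -> bool}) fourier_o_right f (Rs s y) * Ms R s &
        fourier_o_right f y =
          \sum_(s : {ffun 'I_n -> bool}) fourier f (Rs s y) * Ms R s]) /\
  (cg_integrable (fourier f) -> cg_integrable (fourier_o f) ->
    forall y : n.-tuple R,
      fourier (fourier f) y = fourier_o (fourier_o f) y).
Proof.
move=> fi; split=> [y|Fi Foi y]; last exact: fourier_fourier.
split.
- rewrite -[LHS]mul1r -sum_Ms mulr_suml; apply: eq_bigr => s _.
  by rewrite [RHS](Ms_fourier_o s (Rs s y) fi) RsK.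
- exact: fourier_oE.
- rewrite -[LHS]mulr1 -sum_Ms mulr_sumr; apply: eq_bigr => s _.
  by rewrite [RHS](fourier_o_right_Ms s (Rs s y) fi) RsK.
- exact: fourier_o_rightE.
Qed.
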